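(* Let $p\in(0,1)$ and $q=1-p$. For any positive integers $K$ and $n$, the expected matching loss of the $K$-chain graph $C_{n,K}$ satisfies $$npq^{K}\left(\frac{(1-q^K)^2}{2-q^K}-\exp\left(-\frac{(n-3K-2)\,pq^K}{2}\right)\right)-1\ \le\ L(C_{n,K})\ \le\ npq^K\left(\frac{(1-q^K)^2}{2-q^K}+q^K+1\right)+1 .$$
   Context: The $K$-chain graph $C_{n,K}$ has vertex set $[n]$ placed in order on a circle; distinct $i,j$ are adjacent iff their circular distance $\min\{|i-j|,\,n-|i-j|\}$ is at most $K$. Under $\mathcal D_p$, the demands $D_j$, $j\in[n]$, are independent, each equal to $1/2$ with probability $p$ and $1$ with probability $q=1-p$. Let $\mathrm{supp}(D)=\{j:D_j=1/2\}$ and let $G[\mathrm{supp}(D)]$ be the induced subgraph. $\mu(H)$ is the maximum matching size of $H$. With $K_n$ the complete graph on $[n]$, $L(G)=2\,\mathbb E_{D\sim\mathcal D_p}\bigl[\mu(K_n[\mathrm{supp}(D)])-\mu(G[\mathrm{supp}(D)])\bigr]$. *)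

(* Defs.v *)
From mathcomp Require Import all_boot all_order all_algebra.
From mathcomp Require Import reals sequences exp.

Set Implicit Arguments.
Unset Strict Implicit.
Unset Printing Implicit Defensive.

Import Order.TTheory GRing.Theory Num.Theory.

Record sgraph (T : finType) := SGraph {
  vertices : {set T};
  edges : {set {set T}};
  edges_simple :
    forall e, e \in edges -> (#|e| == 2) && (e \subset vertices) }.

Section Graphs.
Variable T : finType.
Implicit Types (G : sgraph T) (adj : rel T) (S : {set T}) (M : {set {set T}}).

(* {i, j} is an edge iff i != j and (adj i j or adj j i). *)
Definition adj_edges adj : {set {set T}} :=
  [set [set x.1; x.2] | x : T * T & (x.1 != x.2) && adj x.1 x.2].

Fact adj_edges_simple adj e :
  e \in adj_edges adj -> (#|e| == 2) && (e \subset [set: T]).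
Proof.
by case/imsetP=> x; rewrite inE => /andP[nx _] ->; rewrite cards2 nx subsetT.
Qed.

Definition graph_of adj : sgraph T := SGraph (@adj_edges_simple adj).

Definition induced_edges G S : {set {set T}} :=
  [set e in edges G | e \subset S].

Fact induced_edges_simple G S e :
  e \in induced_edges G S -> (#|e| == 2) && (e \subset vertices G :&: S).
Proof.
by rewrite inE subsetI => /andP[/edges_simple/andP[-> ->] ->].
Qed.

Definition induced G S : sgraph T := SGraph (@induced_edges_simple G S).

Definition is_matching G M : bool := (M \subset edges G) && trivIset M.

Definition matching_number G : nat :=
  \max_(M : {set {set T}} | is_matching G M) #|M|.

End Graphs.

(* The vertex set [n] = {1, ..., n} is represented by 'I_n = {0, ..., n-1}. *)
Definition complete_graph (n : nat) : sgraph 'I_n := graph_of (fun _ _ => true).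

Definition circ_dist (n : nat) (i j : 'I_n) : nat :=
  minn `|i - j|%N (n - `|i - j|%N).

Definition chain_graph (n K : nat) : sgraph 'I_n :=
  graph_of (fun i j => circ_dist i j <= K).

Local Open Scope ring_scope.

(* The two-element type {1/2, 1}, as a subtype of R. *)
Notation demand R := (seq_sub [:: 2^-1; 1 : R]).

Section Demands.
Variables (R : realType) (n : nat) (p : R).
Implicit Types (D : {ffun 'I_n -> demand R}) (G : sgraph 'I_n).

Definition demand_prob (d : demand R) : R :=
  if val d == 2^-1 then p else 1 - p.

(* D_p: independence of the D_j means that the law of D is a product. *)
Definition demands_prob D : R := \prod_j demand_prob (D j).

Definition expectation_Dp (f : {ffun 'I_n -> demand R} -> R) : R :=
  \sum_D demands_prob D * f D.

Definition supp D : {set 'I_n} := [set j | val (D j) == 2^-1].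

Definition matching_loss G : R :=
  2 * expectation_Dp (fun D =>
        (matching_number (induced (complete_graph n) (supp D)))%:R
        - (matching_number (induced G (supp D)))%:R).

End Demands.

(* Main.v *)
Require Import Defs.
From mathcomp Require Import all_boot all_order all_algebra zify ring lra.
From mathcomp Require Import reals sequences exp.

(** For the induced chain graph on a set S, |S| - 2 mu is the number of odd
    components, and for the complete graph it is the parity of |S|; hence L is
    the expected number of odd components up to an error of 1.

    Upper bound: a greedy matching along the line leaves unmatched at most one
    vertex per vertex preceded by K absent ones, plus one.  Each position is
    such a vertex with probability p q^K.

    Lower bound: every odd component that follows a gap of length K contains an
    unmatched vertex.  By rotation invariance such a component starts at a
    given place with probability p q^K v, where v is the probability that
    reading the remaining n - K - 1 independent bits up to the first run of K
    zeros finds an odd component.  With x = q^K, the vector of parity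
    probabilities, indexed by the length of the current run of zeros, is at
    distance at most (1 - p x)^m from its stationary value after m bits, and
    that value is 1 / (2 - x) >= (1 - x)^2 / (2 - x) at a start. *)

Set Implicit Arguments.
Unset Strict Implicit.
Unset Printing Implicit Defensive.

Import Order.TTheory GRing.Theory Num.Theory.

(** * Reading components off binary words *)

(* Parity of the component of a point, read off the word [s] of the following
   positions: [g] zeros have been seen since the last point of the component,
   [b] is the parity of the points so far, and the K-th consecutive zero (or the
   end of the word) closes the component. *)
Fixpoint scan (K g : nat) (b : bool) (s : seq bool) : bool :=
  match s with
  | [::] => b
  | true :: t => scan K 0 (~~ b) t
  | false :: t => if g.+1 == K then b else scan K g.+1 b t
  end.

(** The event that a component starts at index K of a window, right after a gap; [H] tests the rest
    of the word and is either [predT] or the parity [scan]. *)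
Definition opens (K : nat) (H : pred (seq bool)) (w : seq bool) : bool :=
  [&& ~~ has id (take K w), nth false w K & H (drop K.+1 w)].

Lemma scan_negb K g b s : scan K g (~~ b) s = ~~ scan K g b s.
Proof. by elim: s g b => [|[] s IH] g b //=; case: ifP. Qed.

(** [c] is where [scan] stops. The last earlier point sits at index [-(g+1)], so the clauses say
    that points before [c] are chained by steps of at most K and that no such step crosses [c]. *)
Lemma scanP K g b s : g < K ->
  exists2 c, scan K g b s = b (+) odd (count id (take c s)) &
  [/\ forall i, i < c -> nth false s i ->
        (i + g < K) || [exists j : 'I_i, nth false s j && (i <= j + K)],
      forall i j, i < c <= j -> nth false s i -> nth false s j -> K < j - i
    & forall j, c <= j -> nth false s j -> K < j + g.+1].
Proof.
elim: s g b => [|[] s IH] g b gK /=.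
- by exists 0; [rewrite addbF | split=> [//|? ? _|? _]; rewrite nth_nil].
- have [|c -> [c1 c2 c3]] := IH 0 (~~ b); first by lia.
  exists c.+1; first by rewrite /= oddD addNb addbN; case: b.
  split.
  + case=> [|i] //= ic si; first by rewrite add0n gK.
    have /orP[iK|/existsP[j /andP[sj ij]]] := c1 _ ic si.
      by apply/orP; right; apply/existsP; exists ord0; rewrite /=; lia.
    apply/orP; right; apply/existsP.
    by exists (lift ord0 j); rewrite /= sj /bump /=; lia.
  + case=> [|i] [|j] //= ij si sj; last by rewrite subSS; exact: c2.
      by have := c3 j ij sj; lia.
    by move: ij; rewrite andbF.
  + by case=> [|j] //= cj sj; have := c3 _ cj sj; lia.
- case: eqP => [gK1|gK1].
    exists 0; first by rewrite addbF.
    by split=> //; case=> [|j] //= _ _; lia.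
  have [|c -> [c1 c2 c3]] := IH g.+1 b; first by lia.
  exists c.+1; first by rewrite /= add0n.
  split.
  + case=> [|i] //= ic si.
    have /orP[iK|/existsP[j /andP[sj ij]]] := c1 _ ic si; first by lia.
    apply/orP; right; apply/existsP.
    by exists (lift ord0 j); rewrite /= sj /bump /=; lia.
  + by case=> [|i] [|j] //= ij si sj; rewrite subSS; exact: c2.
  + by case=> [|j] //= cj sj; have := c3 _ cj sj; lia.
Qed.

(** * Greedy matchings and the parity obstruction *)

Section Matchings.
Variable n : nat.
Implicit Types (S X : {set 'I_n}) (M : {set {set 'I_n}}).

(* Linear, not circular: a point of [S] below [K] with no smaller point in [S]
   is a gap start. *)
Definition gap_starts K S : {set 'I_n} :=
  [set j in S | ~~ [exists i in S, i < j <= i + K]].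

Lemma matchingP (G : sgraph 'I_n) X M : is_matching (induced G X) M ->
  [/\ forall e, e \in M -> #|e| = 2, #|cover M| = 2 * #|M| & cover M \subset X].
Proof.
case/andP=> /subsetP sM tM.
have e2 e : e \in M -> #|e| = 2.
  by move/sM/edges_simple/andP=> [/eqP].
split=> //.
  by rewrite -(eqP tM) (eq_bigr (fun=> 2)) // sum_nat_const mulnC.
by apply/bigcupsP=> e /sM /edges_simple /andP[_]; rewrite subsetI => /andP[].
Qed.

Lemma card_le_matching_number (G : sgraph 'I_n) M :
  is_matching G M -> #|M| <= matching_number G.
Proof.
by move=> Mm; rewrite /matching_number (bigD1 M) //= leq_maxl.
Qed.

Lemma matching_number_le (G : sgraph 'I_n) X :
  2 * matching_number (induced G X) <= #|X|.
Proof.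
suff : matching_number (induced G X) <= #|X| %/ 2 by lia.
apply/bigmax_leqP => M /matchingP[_ M2 /subset_leq_card]; rewrite M2; lia.
Qed.

Lemma ord_max_set S (i0 : 'I_n) : i0 \in S ->
  exists2 a : 'I_n, a \in S & forall i, i \in S -> i <= a.
Proof. by move=> i0S; case: (arg_maxnP val i0S) => a; exists a. Qed.

(** [A] lies on top of [S], so no surviving point loses a predecessor and no new start appears. *)
Lemma gap_starts_setD K S (a : 'I_n) (A : {set 'I_n}) : a \in A -> A \subset S ->
  (forall i, i \in S -> i \notin A -> forall b, b \in A -> i < b) ->
  gap_starts K (S :\: A) \subset gap_starts K S :\ a.
Proof.
move=> aA AS ltA; apply/subsetP=> j; rewrite !inE.
case/andP=> /andP[jA jS] /exists_inPn hj; rewrite jS.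
have -> /= : j != a by apply: contraNneq jA => ->.
apply/exists_inPn=> i iS; have [iA|iA] := boolP (i \in A).
  by have := ltA _ jS jA _ iA; lia.
by apply: hj; rewrite inE iA.
Qed.

Lemma chain_graph_edge K (i j : 'I_n) : i != j -> circ_dist i j <= K ->
  [set i; j] \in edges (chain_graph n K).
Proof. by move=> ij d; apply/imsetP; exists (i, j); rewrite ?inE ?ij. Qed.

(* Greedy from the top: a largest element that does not open a gap is matched
   with its predecessor; neither removal creates a new start. *)
Lemma greedy_matching K S :
  exists2 M, is_matching (induced (chain_graph n K) S) M
           & #|S| <= 2 * #|M| + #|gap_starts K S|.
Proof.
have [m] := ubnP #|S|; elim: m S => // m IH S Sm.
have [->|/set0Pn[a0 a0S]] := eqVneq S set0.
  exists set0; last by rewrite cards0.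
  by rewrite /is_matching sub0set; apply/trivIsetP=> A B; rewrite inE.
have [a aS amax] := ord_max_set a0S.
have cSa : #|S| = #|S :\ a|.+1 by rewrite (cardsD1 a) aS.
have ltSa i : i \in S -> i != a -> i < a.
  by move=> iS ia; rewrite ltn_neqAle -val_eqE in ia *; rewrite ia; exact: amax.
have [ast|] := boolP (a \in gap_starts K S).
  have [|M Mm cM] := IH (S :\ a); first by lia.
  exists M.
    case/andP: Mm => /subsetP sM tM; rewrite /is_matching tM andbT.
    apply/subsetP=> e /sM; rewrite !inE => /andP[-> /=] es.
    exact: subset_trans es (subD1set _ _).
  have /subset_leq_card : gap_starts K (S :\ a) \subset gap_starts K S :\ a.
    apply: gap_starts_setD; rewrite ?set11 ?sub1set // => i iS.
    by rewrite inE => ia b /set1P ->; exact: ltSa.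
  have cst : #|gap_starts K S| = #|gap_starts K S :\ a|.+1.
    by rewrite (cardsD1 a) ast.
  by lia.
rewrite inE aS negbK => /exists_inP[b0 b0S b0a].
have b0D : b0 \in S :\ a by rewrite !inE b0S andbT -val_eqE /=; lia.
have [b bD bmax] := ord_max_set b0D.
have cSb : #|S :\ a| = #|S :\: [set a; b]|.+1.
  by rewrite (cardsD1 b) bD setDDl.
move: bD; rewrite !inE => /andP[ba bS].
have ba' : b < a by exact: ltSa.
have [|M Mm cM] := IH (S :\: [set a; b]).
  by lia.
have dM e : e \in M -> [disjoint [set a; b] & e].
  case/andP: Mm => /subsetP sM _ /sM; rewrite inE => /andP[_].
  by rewrite subsetD disjoint_sym => /andP[].
have [e2 _ _] := matchingP Mm.
exists ([set a; b] |: M).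
  case/andP: Mm => /subsetP sM tM; apply/andP; split.
    apply/subsetP=> e /setU1P[->|/sM]; rewrite !inE.
      rewrite subUset !sub1set aS bS !andbT chain_graph_edge ?(eq_sym a) //.
      (* [b0] is within K below [a], and [b0 <= b < a] by maximality of [b]. *)
      by rewrite /circ_dist geq_min; have := bmax b0 b0D; rewrite /=; lia.
    by case/andP=> -> /subsetDP[].
  apply/trivIsetP=> A B /setU1P[->|AM] /setU1P[->|BM]; rewrite ?eqxx // => AB.
  - exact: dM.
  - by rewrite disjoint_sym dM.
  - by move/trivIsetP: tM; apply.
have abM : [set a; b] \notin M.
  apply/negP=> /[dup] /dM; rewrite -setI_eq0 setIid => /eqP-> /e2.
  by rewrite cards0.
have -> : #|[set a; b] |: M| = #|M|.+1 by rewrite cardsU1 abM.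
have /subset_leq_card : gap_starts K (S :\: [set a; b]) \subset gap_starts K S :\ a.
  apply: gap_starts_setD; rewrite ?set21 ?subUset ?sub1set ?aS ?bS // => i iS.
  rewrite !inE negb_or => /andP[ia ib] c /set2P[]->; first exact: ltSa.
  have iD : i \in S :\ a by rewrite !inE ia.
  by have := bmax i iD; rewrite leq_eqVlt => /orP[|//]; rewrite val_eqE (negPf ib).
have : #|gap_starts K S :\ a| <= #|gap_starts K S|.
  by rewrite subset_leq_card ?subD1set.
by lia.
Qed.

(** Two points below K are less than K apart, so the larger one follows no gap. *)
Lemma card_gap_starts_low K S : #|[set j in gap_starts K S | j < K]| <= 1.
Proof.
apply/card_le1_eqP=> i j.
have lt_ord (x y : 'I_n) : x \in S -> y \in gap_starts K S -> y < K -> ~~ (x < y).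
  by move=> xS; rewrite inE => /andP[_ /exists_inPn/(_ x xS)]; lia.
rewrite !inE -!andbA => /and3P[iS gi iK] /and3P[jS gj jK]; apply: val_inj => /=.
have := lt_ord i j iS; have := lt_ord j i jS.
rewrite !inE iS jS gi gj /= => /(_ isT iK) ? /(_ isT jK) ?; lia.
Qed.

Lemma card_le_chain_matching K S :
  #|S| <= 2 * matching_number (induced (chain_graph n K) S)
          + #|[set j in gap_starts K S | K <= j]| + 1.
Proof.
have [M Mm /leq_trans] := greedy_matching K S; apply.
have := card_le_matching_number Mm.
have : #|gap_starts K S| <= #|[set j in gap_starts K S | K <= j]|
                            + #|[set j in gap_starts K S | j < K]|.
  apply: leq_trans (leq_card_setU _ _).
  rewrite subset_leq_card //; apply/subsetP=> j.
  by rewrite !inE => -> /=; case: ltnP.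
by have := card_gap_starts_low K S; lia.
Qed.

(** The chain bound with gap length [n]: no start has index at least [n], and chain matchings are
    matchings of the complete graph. *)
Lemma card_le_complete_matching S :
  #|S| <= 2 * matching_number (induced (complete_graph n) S) + 1.
Proof.
apply: leq_trans (card_le_chain_matching n S) _.
have -> : [set j in gap_starts n S | n <= j] = set0.
  by apply/setP=> j; rewrite !inE leqNgt ltn_ord andbF.
rewrite cards0 addn0 leq_add2r leq_mul2l /=.
apply/bigmax_leqP=> M /andP[/subsetP sM tM].
apply: card_le_matching_number.
rewrite /is_matching tM andbT; apply/subsetP=> e /sM; rewrite !inE.
case/andP=> /imsetP[x]; rewrite inE => /andP[nx _] -> ->; rewrite andbT.
by apply/imsetP; exists x; rewrite ?inE ?nx.
Qed.

(** If [M] covered [B], its edges inside [B] would partition [B] into pairs. *)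
Lemma odd_closed_unmatched (G : sgraph 'I_n) X M (B : {set 'I_n}) :
  is_matching (induced G X) M -> odd #|B| ->
  (forall e, e \in M -> (e \subset B) || [disjoint e & B]) ->
  exists2 u, u \in B & u \notin cover M.
Proof.
move=> Mm oB cB; have [e2 _ _] := matchingP Mm; case/andP: Mm => _ tM.
apply/exists_inP; rewrite -[X in is_true X]negbK; apply/negP=> /exists_inPn hB.
move: oB; have -> : B = cover [set e in M | e \subset B].
  apply/eqP; rewrite eqEsubset; apply/andP; split; last first.
    by apply/bigcupsP=> e; rewrite inE => /andP[].
  apply/subsetP=> u uB; have := hB u uB; rewrite negbK => /bigcupP[e eM ue].
  apply/bigcupP; exists e => //; rewrite inE eM.
  have /orP[//|/disjointFr/(_ ue)] := cB e eM; by rewrite uB.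
have t' : trivIset [set e in M | e \subset B].
  by apply: trivIsetS tM; apply/subsetP=> e; rewrite inE => /andP[].
rewrite -(eqP t') (eq_bigr (fun=> 2)).
  by rewrite sum_nat_const muln2 odd_double.
by move=> e; rewrite inE => /andP[/e2].
Qed.

End Matchings.

(** * Windows on the circle and their odd components *)

Lemma card_nth_take N (w : seq bool) m : size w = N ->
  #|[set i : 'I_N | (i < m) && nth false w i]| = count id (take m w).
Proof.
move=> sw; rewrite -sum1_count (big_nth false) big_mkord -sum1_card.
have le : size (take m w) <= N by rewrite size_take; case: ltnP => //; lia.
rewrite (big_ord_widen_cond _ (fun i => nth false (take m w) i) (fun=> 1) le).
apply: eq_bigl => i; rewrite inE.
have -> : (i < size (take m w)) = (i < m).
  by rewrite size_take sw; have := ltn_ord i; case: ifP; lia.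
by case: ltnP => im; rewrite ?andbF ?andbT // nth_take.
Qed.

Section Windows.
Variable n : nat.
Implicit Types (S : {set 'I_n.+1}) (M : {set {set 'I_n.+1}}).

(** Indices wrap around through [inZp], so each [a] reads the whole circle exactly once. *)
Definition window S (a : nat) : seq bool :=
  mkseq (fun k => (inZp (a + k) : 'I_n.+1) \in S) n.+1.

Lemma eq_inZp x y : (inZp x == inZp y :> 'I_n.+1) = (x == y %[mod n.+1]).
Proof. by rewrite -val_eqE. Qed.

Lemma inZp_add_inj a i j : i <= n -> j <= n ->
  inZp (a + i) = inZp (a + j) :> 'I_n.+1 -> i = j.
Proof.
by move=> ? ? /eqP; rewrite eq_inZp eqn_modDl !modn_small //= => /eqP.
Qed.

Lemma inZp_add_surj a (y : 'I_n.+1) : exists i : 'I_n.+1, y = inZp (a + i).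
Proof.
have inj : injective (fun i : 'I_n.+1 => inZp (a + i) : 'I_n.+1).
  by move=> i j /inZp_add_inj e; apply/val_inj/e; rewrite -ltnS ltn_ord.
by exists (invF inj y); rewrite (f_invF inj).
Qed.

Lemma circ_dist_shift a i j : i < j <= n ->
  circ_dist (inZp (a + i) : 'I_n.+1) (inZp (a + j)) = minn (j - i) (n.+1 - (j - i)).
Proof.
move=> ij; rewrite /circ_dist /=.
rewrite -(modnDml a i) -(modnDml a j); have := ltn_pmod a (ltn0Sn n).
move: (a %% n.+1) => {}a an.
have modE k : k <= n -> (a + k) %% n.+1 = if a + k <= n then a + k else a + k - n.+1.
  move=> kn; case: leqP => ak; first by rewrite modn_small.
  by rewrite -{1}(subnK ak) modnDr modn_small //; lia.
rewrite !modE; [|lia|lia].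
by case: ifP; case: ifP; lia.
Qed.

Lemma circ_distC (x y : 'I_n.+1) : circ_dist x y = circ_dist y x.
Proof. by rewrite /circ_dist distnC. Qed.

Lemma nth_window S a i : nth false (window S a) i = (i <= n) && (inZp (a + i) \in S).
Proof.
have [ile|ige] := leqP i n; first by rewrite nth_mkseq.
by rewrite nth_default // size_mkseq.
Qed.

Lemma opens_window K H S a : opens K H (window S a) ->
  [/\ K <= n, inZp (a + K) \in S, forall i, i < K -> inZp (a + i) \notin S
    & H (drop K.+1 (window S a))].
Proof.
rewrite /opens nth_window => /and3P[/hasPn nK /andP[Kn aK] ->]; split=> // i iK.
have /nK : nth false (take K (window S a)) i \in take K (window S a).
  by rewrite mem_nth // size_take size_mkseq; case: ifP; lia.
by rewrite nth_take // nth_window; case: leqP => //=; lia.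
Qed.

(** The points of the window up to the cut of [scanP] form an odd set closed under edges, so one of
    them is unmatched. The absence of gaps before it serves to recover [a] from that vertex. *)
Lemma odd_window_unmatched K S M (a : nat) : 0 < K ->
  is_matching (induced (chain_graph n.+1 K) S) M ->
  opens K (scan K 0 true) (window S a) ->
  exists2 i, K <= i <= n &
    (inZp (a + i) \in S :\: cover M) /\
    forall j, K < j <= i -> inZp (a + j) \in S ->
      exists2 l, l < j <= l + K & inZp (a + l) \in S.
Proof.
move=> K0 Mm /opens_window [Kn SK SltK].
have [c -> [c1 c2 c3]] := scanP true (drop K.+1 (window S a)) K0.
have nthE i : nth false (drop K.+1 (window S a)) i =
    (K.+1 + i <= n) && (inZp (a + (K.+1 + i)) \in S).
  by rewrite nth_drop nth_window.
rewrite addTb => even_c.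
(* [scan] reads the word after K zeros and the starting vertex, hence the offset [K.+1]. *)
pose I := [set i : 'I_n.+1 | (i < K.+1 + c) && nth false (window S a) i].
pose B : {set 'I_n.+1} := [set inZp (a + i) | i : 'I_n.+1 in I].
have IP (i : 'I_n.+1) : i \in I -> [/\ K <= i, i < K.+1 + c & inZp (a + i) \in S].
  rewrite inE nth_window => /and3P[-> _ iS]; split=> //.
  by rewrite leqNgt; apply: contraL iS => /SltK.
have oB : odd #|B|.
  rewrite card_in_imset; last first.
    move=> i j _ _ /inZp_add_inj e; apply/val_inj/e; by rewrite -ltnS ltn_ord.
  rewrite card_nth_take ?size_mkseq // addnC -[c + _]/(c + K.+1).
  have -> : take (c + K.+1) (window S a) =
    take K (window S a) ++ true :: take c (drop K.+1 (window S a)).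
    rewrite take_drop -{1}[take (c + _) _](cat_take_drop K.+1).
    rewrite take_takel ?leq_addl // (take_nth false) ?size_mkseq //.
    by rewrite nth_window Kn SK cat_rcons.
  rewrite count_cat /= (_ : count id _ = 0) ?add0n ?add1n //=.
  apply/eqP; rewrite -leqn0 leqNgt -has_count; apply/(has_nthP false) => -[i].
  rewrite size_take size_mkseq => iK; have {}iK : i < K by move: iK; case: ifP; lia.
  by rewrite nth_take // nth_window (negPf (SltK _ iK)) andbF.
have clB x y : x \in B -> y \in S -> circ_dist x y <= K -> y \in B.
  case/imsetP=> i iI -> yS; have [j yE] := inZp_add_surj a y.
  rewrite yE in yS *; have [Ki ic iS] := IP i iI.
  have jn : j <= n by rewrite -ltnS.
  have in_ : i <= n by rewrite -ltnS.
  have Kj : K <= j by rewrite leqNgt; apply: contraL yS => /SltK.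
  have [jc|jc] := ltnP j (K.+1 + c).
    by move=> _; apply: imset_f; rewrite inE jc nth_window jn.
  rewrite circ_dist_shift; last lia.
  (* Going round the other way is too long: [K <= i] and [j <= n]. *)
  suff : K < j - i by lia.
  have sj : nth false (drop K.+1 (window S a)) (j - K.+1).
    by rewrite nthE subnKC ?jn //; lia.
  (* Here [i = K] is the starting vertex, which precedes the scanned word. *)
  have [iK|iK] := leqP i K; first by have := c3 (j - K.+1) _ sj; lia.
  have := c2 (i - K.+1) (j - K.+1); rewrite !nthE !subnKC ?in_ ?jn //; lia.
have [|u uB uM] := odd_closed_unmatched Mm oB.
  move=> e; case/andP: Mm => /subsetP sM _ /sM.
  rewrite inE => /andP[/imsetP[[x y]]]; rewrite inE /= => /andP[_ dxy] ->.
  rewrite !subUset !sub1set => /andP[xS yS].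
  have [xB|xB] := boolP (x \in B); first by rewrite (clB x y).
  have yB : y \notin B.
    by apply: contra xB => yB; apply: clB yB xS _; rewrite circ_distC.
  by rewrite disjoints_subset subUset !sub1set !inE xB yB.
case/imsetP: uB uM => i iI -> uM; have [Ki ic iS] := IP i iI.
exists i; first by rewrite Ki -ltnS ltn_ord.
split; first by rewrite inE uM iS.
move=> j /andP[Kj ji] jS.
have sj : nth false (drop K.+1 (window S a)) (j - K.+1).
  by rewrite nthE subnKC // jS andbT; have := ltn_ord i; lia.
have [|jK|/existsP[l /andP[sl jl]]] := orP (c1 (j - K.+1) _ sj); first by lia.
  by exists K => //; lia.
move: sl; rewrite nthE => /andP[_ lS].
by exists (K.+1 + l) => //; have := ltn_ord l; lia.
Qed.

(* An unmatched vertex of the component opened by window [a] determines [a]: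
   it lies in no gap-free run opened by another window. *)
Lemma card_odd_windows K S M : 0 < K ->
  is_matching (induced (chain_graph n.+1 K) S) M ->
  #|[set a : 'I_n.+1 | opens K (scan K 0 true) (window S a)]| + 2 * #|M| <= #|S|.
Proof.
move=> K0 Mm; set A := [set a : 'I_n.+1 | _].
have [_ cM cS] := matchingP Mm.
have ex (a : 'I_n.+1) : exists i : 'I_n.+1, a \in A ->
    [/\ K <= i, inZp (a + i) \in S :\: cover M &
    forall j, K < j <= i -> inZp (a + j) \in S ->
      exists2 l, l < j <= l + K & inZp (a + l) \in S].
  (* Outside [A] the index is a placeholder that makes [f] total. *)
  have [|aA] := boolP (a \in A); last by exists a.
  rewrite inE => /(odd_window_unmatched K0 Mm)[i /andP[Ki iN] [iS ih]].
  by exists (Ordinal (iN : i < n.+1)).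
have [f fP] := fin_all_exists ex.
pose g (a : 'I_n.+1) : 'I_n.+1 := inZp (a + f a).
(* If [f a < f b], the gap opening window [a] lies in window [b] before index [f b], and the start
   after it would need a predecessor inside that gap. *)
have key (a b : 'I_n.+1) : a \in A -> b \in A -> g a = g b -> f b <= f a.
  move=> aA bA /eqP; rewrite eq_inZp leqNgt => gab; apply/negP => fab.
  have [Ka _ _] := fP a aA; have [_ _ hb] := fP b bA.
  have shift k : inZp (a + k) = inZp (b + (f b - f a) + k) :> 'I_n.+1.
    apply/eqP; rewrite eq_inZp eqn_modDr -(eqn_modDr (f a)).
    by rewrite -addnA subnK // ltnW.
  move: aA; rewrite inE => /opens_window [Kn aK altK _].
  have [||l ll lS] := hb (f b - f a + K); first by lia.
    by rewrite addnA -shift.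
  have /altK/negP[] : l - (f b - f a) < K by lia.
  by rewrite shift -addnA subnKC //; lia.
have g_inj : {in A &, injective g}.
  move=> a b aA bA gab; have [Ka _ _] := fP a aA.
  have fab : f a = f b.
    by apply/val_inj/eqP; rewrite /= eqn_leq !key.
  move/eqP: gab; rewrite eq_inZp fab eqn_modDr !modn_small // => /eqP.
  exact: val_inj.
have : #|g @: A| <= #|S :\: cover M|.
  apply/subset_leq_card/subsetP=> _ /imsetP[a aA ->].
  by have [] := fP a aA.
rewrite card_in_imset // cardsD (setIidPr cS) cM.
by have := subset_leq_card cS; rewrite cM; lia.
Qed.

End Windows.

Local Open Scope ring_scope.

(** * Expectations over independent bits *)

Section WordExpectation.
Variables (R : realType) (p : R).

(** Conditioning on the first bit turns the recursion of [scan] into a linear recurrence. *)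
Fixpoint word_exp (m : nat) (F : seq bool -> R) : R :=
  if m is m'.+1 then
    p * word_exp m' (fun w => F (true :: w))
    + (1 - p) * word_exp m' (fun w => F (false :: w))
  else F [::].

Lemma word_expS m F : word_exp m.+1 F =
  p * word_exp m (fun w => F (true :: w))
  + (1 - p) * word_exp m (fun w => F (false :: w)).
Proof. by []. Qed.

Lemma eq_word_exp m F G : F =1 G -> word_exp m F = word_exp m G.
Proof.
by elim: m F G => [|m IH] F G FG //=; rewrite (IH _ _ (fun w => FG (_ :: w)))
  (IH (fun w => F (false :: w)) _ (fun w => FG (_ :: w))).
Qed.

Lemma word_exp_cst m c : word_exp m (fun=> c) = c.
Proof. by elim: m => //= m ->; ring. Qed.

Lemma word_exp_negb m (H : pred (seq bool)) :
  word_exp m (fun w => (~~ H w)%:R) = 1 - word_exp m (fun w => (H w)%:R).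
Proof.
elim: m H => [|m IH] H /=; first by case: H; rewrite ?subrr ?subr0.
by rewrite !IH; ring.
Qed.

Lemma word_exp_opens K l H :
  word_exp (K.+1 + l) (fun w => (opens K H w)%:R)
  = p * (1 - p) ^+ K * word_exp l (fun w => (H w)%:R).
Proof.
elim: K => [|K IH].
  rewrite add1n word_expS (@eq_word_exp _ (fun w => (opens 0 H (false :: w))%:R) (fun=> 0)) //.
  rewrite word_exp_cst mulr0 addr0 expr0 mulr1.
  by congr (_ * _); apply: eq_word_exp => w; rewrite /opens /= drop0.
rewrite addSn word_expS.
rewrite (@eq_word_exp _ (fun w => (opens K.+1 H (true :: w))%:R) (fun=> 0)) //.
rewrite (@eq_word_exp _ (fun w => (opens K.+1 H (false :: w))%:R)
  (fun w => (opens K H w)%:R)) // IH word_exp_cst exprS.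
by ring.
Qed.

(* From gap length [g], with [k = K - g] and [x = (1 - p) ^ K], the stationary
   value of the parity probability is [1 - (1 - (1 - p) ^ k) / (2 - x)]; the
   weights [1 - (1 - p) ^ k] form a supersolution decaying at rate [1 - p x]. *)
Lemma word_exp_scan K g m : 0 < p -> p < 1 -> (g < K)%N ->
  `|word_exp m (fun w => (scan K g true w)%:R)
    - (1 - (1 - (1 - p) ^+ (K - g)) / (2 - (1 - p) ^+ K))|
  <= (1 - (1 - p) ^+ (K - g)) / (2 - (1 - p) ^+ K) * (1 - p * (1 - p) ^+ K) ^+ m.
Proof.
move=> p0 p1; have [q qE] : exists q : R, q = 1 - p by exists (1 - p).
have [x xE] : exists x : R, x = q ^+ K by exists (q ^+ K).
have [T TE] : exists T : R, T = (2 - x)^-1 by exists (2 - x)^-1.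
rewrite -!qE -!xE -!TE.
have [q0 q1] : 0 <= q /\ q <= 1 by lra.
have pw k : 0 <= q ^+ k <= 1 by rewrite exprn_ge0 ?exprn_ile1.
have /andP[x0 x1] : 0 <= x <= 1 by rewrite xE.
have T0 : 0 < T by rewrite TE invr_gt0; lra.
have Tx : T * (2 - x) = 1 by rewrite TE mulVf //; lra.
have px0 : 0 <= p * x by rewrite mulr_ge0 // ltW.
have px1 : p * x <= 1 by rewrite mulr_ile1 // ltW.
elim: m g => [|m IH] g gK.
  rewrite expr0 mulr1 /= opprB addrC subrK.
  rewrite ger0_norm // mulr_ge0 ?(ltW T0) // subr_ge0.
  by have /andP[] := pw (K - g)%N.
have K0 : (0 < K)%N by lia.
have := IH 0%N K0; rewrite subn0 -xE.
rewrite word_expS -qE.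
(* A one resets the gap and flips the parity, so this branch is the complement of the value at gap
   0. *)
rewrite (@eq_word_exp m (fun w => (scan K 0 false w)%:R)
          (fun w => (~~ scan K 0 true w)%:R)); last first.
  by move=> w; rewrite -scan_negb.
rewrite word_exp_negb; set v := word_exp m _.
set V := word_exp m _ => Hv.
have -> : (K - g)%N = (K - g.+1).+1 by lia.
(* If [g.+1 = K], the zero closes an odd component: the value is exactly 1 and the error bound is
   0. *)
have HV : `|V - (1 - (1 - q ^+ (K - g.+1)) * T)|
    <= (1 - q ^+ (K - g.+1)) * T * (1 - p * x) ^+ m.
  rewrite /V; have [gK1|gK1] := eqVneq g.+1 K.
    rewrite (@eq_word_exp m _ (fun=> 1)) ?word_exp_cst; last first.
      by move=> w /=; rewrite gK1 eqxx.
    by rewrite gK1 subnn expr0 subrr !mul0r subr0 subrr normr0.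
  rewrite (@eq_word_exp m _ (fun w => (scan K g.+1 true w)%:R)); last first.
    by move=> w /=; rewrite (negPf gK1).
  by apply: IH; lia.
have rm : 0 <= (1 - p * x) ^+ m by rewrite exprn_ge0 //; lra.
move: Hv HV rm (pw (K - g.+1)%N); rewrite !exprS.
move: v V ((1 - p * x) ^+ m) (q ^+ (K - g.+1)) => v V r y Hv HV r0 /andP[y0 y1].
(* The stationary values solve the recurrence because [T * (2 - x) = 1], so only the errors
   remain. *)
have -> : p * (1 - v) + q * V - (1 - (1 - q * y) * T) =
  q * (V - (1 - (1 - y) * T)) - p * (v - (1 - (1 - x) * T)).
  have -> : p = 1 - q by rewrite qE; ring.
  transitivity (q * (V - (1 - (1 - y) * T)) - (1 - q) * (v - (1 - (1 - x) * T))
     + (1 - q) * (T * (2 - x) - 1)); first by ring.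
  by rewrite Tx; ring.
apply: le_trans (ler_normB _ _) _.
rewrite !normrM (ger0_norm (ltW p0)) (ger0_norm (_ : 0 <= q)); last by lra.
apply: le_trans (lerD (ler_wpM2l _ HV) (ler_wpM2l (ltW p0) Hv)) _; first by lra.
rewrite -subr_ge0.
(* The slack of the supersolution, a product of nonnegative factors. *)
have -> : (1 - q * y) * T * ((1 - p * x) * r) -
  (q * ((1 - y) * T * r) + p * ((1 - x) * T * r)) = T * r * (q * y * (p * x)).
  by rewrite qE; ring.
by rewrite !mulr_ge0 //; lra.
Qed.

End WordExpectation.

(** * From random demands to random sets and words *)

Section SetExpectation.
Variables (R : realType) (p : R).

Definition bern (b : bool) : R := if b then p else 1 - p.

Definition set_exp n (f : {set 'I_n} -> R) : R :=
  \sum_(X : {ffun 'I_n -> bool}) (\prod_j bern (X j)) * f [set j | X j].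

(** Since [1/2] and [1] differ, demands correspond bijectively to bits. *)
Lemma expectation_Dp_supp n (f : {set 'I_n} -> R) :
  expectation_Dp p (fun D => f (supp D)) = set_exp f.
Proof.
have h_in : 2^-1 \in [:: 2^-1; 1 : R] by rewrite inE eqxx.
have o_in : 1 \in [:: 2^-1; 1 : R] by rewrite !inE eqxx orbT.
pose dem (b : bool) : demand R := if b then SeqSub h_in else SeqSub o_in.
have demE b : (val (dem b) == 2^-1) = b.
  case: b; rewrite /dem /= ?eqxx //; apply/eqP => /(congr1 (fun x => 2 * x)).
  by rewrite mulr1 divff ?pnatr_eq0 // => /eqP; rewrite (eqr_nat _ 2 1).
have demK : cancel dem (fun d => val d == 2^-1) by move=> b; exact: demE.
have demK' : cancel (fun d : demand R => val d == 2^-1) dem.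
  move=> d; apply: val_inj; have := valP d; rewrite !inE /dem.
  by case: ifP => [/eqP -> //|_ /= /eqP ->].
pose F (X : {ffun 'I_n -> bool}) : {ffun 'I_n -> demand R} := [ffun i => dem (X i)].
rewrite /expectation_Dp (reindex F) /=; last first.
  exists (fun D => [ffun i => val (D i) == 2^-1]) => X _; apply/ffunP => i.
    by rewrite !ffunE demE.
  by rewrite !ffunE demK'.
apply: eq_bigr => X _; congr (_ * f _).
  by apply: eq_bigr => i _; rewrite /demand_prob ffunE demE.
by apply/setP=> i; rewrite !inE ffunE demE.
Qed.

Lemma sum_ffun_word m (F : seq bool -> R) :
  \sum_(X : {ffun 'I_m -> bool})
     (\prod_j bern (X j)) * F [seq X i | i <- enum 'I_m] = word_exp p m F.
Proof.
elim: m F => [|m IH] F.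
  have -> : enum 'I_0 = [::] by apply: size0nil; rewrite size_enum_ord.
  under eq_bigr do rewrite big_ord0 mul1r.
  by rewrite /= sumr_const card_ffun card_ord expn0.
pose h (bX : bool * {ffun 'I_m -> bool}) : {ffun 'I_m.+1 -> bool} :=
  [ffun i => oapp bX.2 bX.1 (unlift ord0 i)].
rewrite (reindex h) /=; last first.
  exists (fun X => (X ord0, [ffun i => X (lift ord0 i)])) => [[b X]|X] _.
    rewrite /h ffunE unlift_none /=; congr (_, _).
    by apply/ffunP=> i; rewrite !ffunE liftK.
  by apply/ffunP=> i; rewrite !ffunE /=; case: unliftP => [j|] -> /=; rewrite ?ffunE.
rewrite -(pair_bigA _ (fun b X =>
  (\prod_j bern (h (b, X) j)) * F [seq h (b, X) i | i <- enum 'I_m.+1])) /=.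
have term b : \sum_(X : {ffun 'I_m -> bool})
    (\prod_j bern (h (b, X) j)) * F [seq h (b, X) i | i <- enum 'I_m.+1]
  = bern b * word_exp p m (fun w => F (b :: w)).
  rewrite -IH big_distrr /=; apply: eq_bigr => X _.
  rewrite big_ord_recl /h ffunE unlift_none /= -mulrA; congr (_ * (_ * F _)).
    by apply: eq_bigr => i _; rewrite ffunE liftK.
  rewrite enum_ordSl /= ffunE unlift_none -map_comp /=; congr (_ :: _).
  by apply: eq_map => i /=; rewrite ffunE liftK.
by rewrite big_bool /= !term.
Qed.

(** Rotation permutes the vertices and so preserves the product law. *)
Lemma set_exp_window n a (F : seq bool -> R) :
  set_exp (fun S : {set 'I_n.+1} => F (window S a)) = word_exp p n.+1 F.
Proof.
pose s (i : 'I_n.+1) : 'I_n.+1 := inZp (a + i).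
have s_inj : injective s.
  by move=> i j /inZp_add_inj e; apply/val_inj/e; rewrite -ltnS ltn_ord.
pose h (X : {ffun 'I_n.+1 -> bool}) : {ffun 'I_n.+1 -> bool} := [ffun i => X (s i)].
have h_inj : injective h.
  move=> X Y /ffunP hXY; apply/ffunP=> i; rewrite -(f_invF s_inj i).
  by have := hXY (invF s_inj i); rewrite !ffunE.
rewrite -sum_ffun_word (reindex_inj h_inj) /=; apply: eq_bigr => X _.
congr (_ * F _).
  by rewrite (reindex_inj s_inj) /=; apply: eq_bigr => i _; rewrite ffunE.
rewrite /window /mkseq -val_enum_ord -map_comp; apply: eq_map => i /=.
by rewrite inE ffunE.
Qed.

Lemma set_expD n (f g : {set 'I_n} -> R) :
  set_exp (fun S => f S + g S) = set_exp f + set_exp g.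
Proof. by rewrite /set_exp -big_split /=; apply: eq_bigr => X _; rewrite mulrDr. Qed.

Lemma set_expM n c (f : {set 'I_n} -> R) :
  set_exp (fun S => c * f S) = c * set_exp f.
Proof. by rewrite /set_exp big_distrr /=; apply: eq_bigr => X _; rewrite mulrCA. Qed.

Lemma set_exp_sum n (I : finType) (f : I -> {set 'I_n} -> R) :
  set_exp (fun S => \sum_i f i S) = \sum_i set_exp (f i).
Proof.
by rewrite /set_exp exchange_big /=; apply: eq_bigr => X _; rewrite big_distrr.
Qed.

Lemma set_exp_cst n (c : R) : set_exp (fun _ : {set 'I_n} => c) = c.
Proof. by rewrite -[RHS](word_exp_cst p n) -sum_ffun_word. Qed.

Lemma le_set_exp n (f g : {set 'I_n} -> R) : 0 <= p <= 1 ->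
  (forall S, f S <= g S) -> set_exp f <= set_exp g.
Proof.
move=> /andP[p0 p1] fg; apply: ler_sum => X _; apply: ler_wpM2l => //.
by apply: prodr_ge0 => j _; rewrite /bern; case: ifP => _; rewrite ?subr_ge0.
Qed.

End SetExpectation.

Lemma natr_card_set (R : realType) (T : finType) (P : pred T) :
  #|[set a | P a]|%:R = \sum_a (P a)%:R :> R.
Proof.
rewrite -sum1_card natr_sum big_mkcond; apply: eq_bigr => a _.
by rewrite inE; case: (P a).
Qed.

(** * Bounds on the expected loss *)

Section Loss.
Variables (R : realType) (p : R) (n K : nat).
Implicit Type S : {set 'I_n.+1}.

Let mu (G : sgraph 'I_n.+1) S : nat := matching_number (induced G S).
Let loss S : R := 2 * ((mu (complete_graph n.+1) S)%:R - (mu (chain_graph n.+1 K) S)%:R).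

Lemma matching_lossE : matching_loss p (chain_graph n.+1 K) = set_exp p loss.
Proof. by rewrite set_expM -expectation_Dp_supp. Qed.

Lemma set_exp_opens a H : (K <= n)%N ->
  set_exp p (fun S => (opens K H (window S a))%:R) =
  p * (1 - p) ^+ K * word_exp p (n - K) (fun w => (H w)%:R).
Proof.
move=> Kn; rewrite (set_exp_window p n a (fun w => (opens K H w)%:R)).
by rewrite -word_exp_opens addSn subnKC.
Qed.

(** As [K <= j], the K positions before [j] are read without wrapping, so the linear gap is a gap of
    the window. *)
Lemma gap_start_opens S (j : 'I_n.+1) :
  j \in gap_starts K S -> (K <= j)%N -> opens K predT (window S (j - K)).
Proof.
rewrite inE => /andP[jS /exists_inPn hj] Kj; have jn := ltn_ord j.
rewrite /opens nth_window subnK // valZpK jS !andbT.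
apply/andP; split; last by lia.
apply/(has_nthP false) => -[i].
rewrite size_take size_mkseq => iK; have {}iK : (i < K)%N by move: iK; case: ifP; lia.
rewrite nth_take // nth_window => /andP[_ iS].
by have := hj _ iS; rewrite /= modn_small; lia.
Qed.

Lemma matching_loss_le : 0 < p -> p < 1 ->
  matching_loss p (chain_graph n.+1 K) <= n.+1%:R * p * (1 - p) ^+ K + 1.
Proof.
move=> p0 p1; have p01 : 0 <= p <= 1 by rewrite !ltW.
have px : 0 <= p * (1 - p) ^+ K by rewrite mulr_ge0 ?exprn_ge0 ?subr_ge0 ?ltW.
pose st S (j : 'I_n.+1) := (j \in gap_starts K S) && (K <= j)%N.
have bound S : loss S <= (\sum_j (st S j)%:R) + 1.
  rewrite -natr_card_set.
  have := card_le_chain_matching K S; have := matching_number_le (complete_graph n.+1) S.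
  rewrite /loss -/(mu _ S) -/(mu _ S) => h1 h2.
  have : (2 * mu (complete_graph n.+1) S <=
          2 * mu (chain_graph n.+1 K) S + #|[set j | st S j]| + 1)%N.
    exact: leq_trans h1 h2.
  by rewrite !mul2n -!addnn -(ler_nat R) !natrD; lra.
rewrite matching_lossE (le_trans (le_set_exp p01 bound)) //.
rewrite set_expD set_exp_cst lerD2r set_exp_sum -mulrA mulr_natl.
rewrite -[X in _ *+ X](card_ord n.+1) -sumr_const; apply: ler_sum => j _.
have [Kj|jK] := leqP K j; last first.
  rewrite (_ : set_exp _ _ = 0) // -[RHS](set_exp_cst p n.+1).
  apply: eq_bigr => X _; by rewrite /st leqNgt jK andbF.
have Kn : (K <= n)%N by have := ltn_ord j; lia.
have := set_exp_opens (j - K) predT Kn; rewrite word_exp_cst mulr1 => <-.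
apply: le_set_exp => // S; rewrite ler_nat /st.
by case: andP => // -[jS _]; rewrite gap_start_opens.
Qed.

Lemma sum_odd_windows_le S : (0 < K)%N ->
  \sum_(a : 'I_n.+1) (opens K (scan K 0 true) (window S a))%:R - 1 <= loss S.
Proof.
move=> K0; rewrite -natr_card_set; set A := [set a | _].
(* Any matching would do: it yields [#|A| <= #|S|], so that the subtraction below is not
   truncated. *)
have [M0 Mm0 _] := greedy_matching K S.
have A_le := card_odd_windows K0 Mm0.
have : (mu (chain_graph n.+1 K) S <= (#|S| - #|A|) %/ 2)%N.
  apply/bigmax_leqP => M Mm; have := card_odd_windows K0 Mm; rewrite -/A; lia.
have := card_le_complete_matching S; rewrite -/(mu _ S) => h1 h2.
have : (#|A| + 2 * mu (chain_graph n.+1 K) S <= 2 * mu (complete_graph n.+1) S + 1)%N.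
  by move: A_le; rewrite -/A; lia.
by rewrite !mul2n -!addnn -(ler_nat R) !natrD /loss; lra.
Qed.

(** Serves circles of at most K vertices, too short for a window to open. *)
Lemma matching_loss_ge : 0 < p -> p < 1 -> (0 < K)%N ->
  -1 <= matching_loss p (chain_graph n.+1 K).
Proof.
move=> p0 p1 K0; have p01 : 0 <= p <= 1 by rewrite !ltW.
rewrite matching_lossE -[-1](set_exp_cst p n.+1); apply: le_set_exp => // S.
apply: le_trans (sum_odd_windows_le S K0).
by rewrite lerBrDr addNr sumr_ge0.
Qed.

Lemma matching_loss_ge_scan : 0 < p -> p < 1 -> (0 < K)%N -> (K <= n)%N ->
  n.+1%:R * p * (1 - p) ^+ K
    * word_exp p (n - K) (fun w => (scan K 0 true w)%:R) - 1
  <= matching_loss p (chain_graph n.+1 K).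
Proof.
move=> p0 p1 K0 Kn; have p01 : 0 <= p <= 1 by rewrite !ltW.
rewrite matching_lossE.
apply: le_trans (le_set_exp p01 (fun S => sum_odd_windows_le S K0)).
rewrite set_expD set_exp_cst lerD2r set_exp_sum.
under eq_bigr do rewrite set_exp_opens //.
by rewrite sumr_const card_ord -[X in _ <= X]mulr_natl !mulrA.
Qed.

End Loss.

(** * Numerical comparison with the closed forms *)

Theorem theoremC1 (R : realType) (p q : R) (hp0 : 0 < p) (hp1 : p < 1)
    (hq : q = 1 - p) (K n : nat) (hK : (0 < K)%N) (hn : (0 < n)%N) :
  n%:R * p * q ^+ K *
      ((1 - q ^+ K) ^+ 2 / (2 - q ^+ K)
       - expR (- ((n%:R - 3 * K%:R - 2) * p * q ^+ K / 2))) - 1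
    <= matching_loss p (chain_graph n K)
  /\
  matching_loss p (chain_graph n K)
    <= n%:R * p * q ^+ K *
         ((1 - q ^+ K) ^+ 2 / (2 - q ^+ K) + q ^+ K + 1) + 1.
Proof.
case: n hn => // n _.
have q0 : 0 <= q by lra.
have q1 : q <= 1 by lra.
have [x xE] : exists x : R, x = q ^+ K by exists (q ^+ K).
have [T TE] : exists T : R, T = (2 - x)^-1 by exists (2 - x)^-1.
have x0 : 0 <= x by rewrite xE exprn_ge0.
have x1 : x <= 1 by rewrite xE exprn_ile1.
have T0 : 0 < T by rewrite TE invr_gt0; lra.
have Tx : T * (2 - x) = 1 by rewrite TE mulVf //; lra.
have T1 : T <= 1 by rewrite TE invf_le1; lra.
have px0 : 0 <= p * x by rewrite mulr_ge0 // ltW.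
have px1 : p * x <= 1 by rewrite mulr_ile1 // ltW.
have npx : 0 <= n.+1%:R * p * x by rewrite -mulrA mulr_ge0.
have sq0 : 0 <= (1 - x) ^+ 2 := sqr_ge0 _.
have sq1 : (1 - x) ^+ 2 <= 1 by rewrite exprn_ile1 //; lra.
rewrite -!xE -!TE; split; last first.
  apply: le_trans (matching_loss_le _ _ hp0 hp1) _; rewrite -hq -xE lerD2r.
  (* The bracket is at least 1. *)
  by rewrite ler_peMr // lerDr addr_ge0 // mulr_ge0 // ltW.
have [Kn|nK] := leqP K n; last first.
  (* With at most K vertices the exponent is nonnegative, so the exponential is at least
     [1 >= (1 - x) ^+ 2 * T] and the bracket is at most 0. *)
  apply: le_trans (matching_loss_ge _ hp0 hp1 hK); rewrite gerDr.
  rewrite mulr_ge0_le0 // subr_le0.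
  apply: (@le_trans _ _ 1).
    by rewrite mulr_ile1 // ltW.
  rewrite -[X in X <= _]expR0 ler_expR oppr_ge0.
  have : n.+1%:R <= K%:R :> R by rewrite ler_nat.
  have : 0 <= K%:R :> R by [].
  move=> hK0 hnK; rewrite -!mulrA mulr_le0_ge0 //; first lra.
  by rewrite mulrA divr_ge0.
apply: le_trans (matching_loss_ge_scan hp0 hp1 hK Kn); rewrite -hq -xE lerD2r.
apply: ler_wpM2l => //.
have := word_exp_scan (n - K) hp0 hp1 hK; rewrite subn0 -hq -xE -TE.
rewrite ler_norml => /andP[+ _]; move: (word_exp _ _ _) => v hv.
set e := expR _.
(* From [1 - t <= exp (- t)]; the exponents compare because [n - K] exceeds [(n + 1 - 3K - 2) / 2]
   by [(n + K + 1) / 2]. *)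
have : (1 - p * x) ^+ (n - K) <= e.
  apply: (@le_trans _ _ (expR (- (p * x)) ^+ (n - K))).
    by rewrite lerXn2r ?nnegrE ?expR_ge0 ?subr_ge0 // expR_ge1Dx.
  rewrite -expRM_natl ler_expR mulrN lerN2 natrB // -natr1.
  have nx : 0 <= n%:R * (p * x) by rewrite mulr_ge0.
  have Kx : 0 <= K%:R * (p * x) by rewrite mulr_ge0.
  lra.
have : 0 <= (1 - p * x) ^+ (n - K) by rewrite exprn_ge0 // subr_ge0.
move: (_ ^+ (n - K)) hv => r hv r0 re.
have : (1 - x) * T * r <= r by rewrite ler_piMl // mulr_ile1 ?(ltW T0) //; lra.
have : (1 - x) ^+ 2 * T <= T by rewrite ler_piMl // ltW.
(* The stationary value at gap 0 is [T] itself. *)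
have : T = 1 - (1 - x) * T by rewrite -{1}Tx; ring.
lra.
Qed.
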